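(* Let $\alpha$ be a composition and $\mu$ a partition, and suppose that in the ring of quasisymmetric functions in $x_1,x_2,\dots$ $$\mathcal{CS}_\alpha\, s_\mu=\sum_{\beta:\ \alpha\subseteq\beta}A^{\beta}_{\alpha\mu}\,\mathcal{CS}_\beta .$$ Then for all $k,l\ge0$, $$\mathcal{HQ}_\alpha(X;Y)\,HS_\mu(X;Y)=\sum_{\beta:\ \alpha\subseteq\beta}A^{\beta}_{\alpha\mu}\,\mathcal{HQ}_\beta(X;Y).$$
   Context: French notation: row $i$ is the $i$-th from the bottom, cell $(i,j)$ is row $i$, column $j$; a composition $\beta=(\beta_1,\dots,\beta_r)$ with largest part $m$ has $\beta_i$ cells in row $i$. $\alpha\subseteq\beta$ means $\ell(\alpha)\le\ell(\beta)$ and $\alpha_i\le\beta_i$ for $i\le\ell(\alpha)$. For a filling $F$ of $\beta$, $\hat F$ is the $r\times m$ array with $\infty$ (larger than everything) in the missing cells. A semistandard Young composition tableau (SSYCT) of shape $\beta$ is a filling $T$ with positive integers such that rows weakly increase left to right, the leftmost column strictly increases bottom to top, and for $1\le i<j\le r$, $1\le n<m$: if $\hat T(i,n+1)\ne\infty$ and $\hat T(i,n+1)\ge\hat T(j,n)$ then $\hat T(i,n+1)>\hat T(j,n+1)$. $\mathcal{CS}_\beta=\sum_T x^T$ over SSYCT $T$ of shape $\beta$, where $x^T=\prod_i x_i^{\#\{\text{entries } i\}}$. $s_\mu$ is the Schur function. Fix $k,l\ge0$, $\mathcal{A}=\{1,\dots,k\}$, $\mathcal{A}'=\{1',\dots,l'\}$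 ordered $1<\dots<k<1'<\dots<l'$, $X=(x_1,\dots,x_k)$, $Y=(y_1,\dots,y_l)$. A semistandard hook tableau (SSHT) of partition shape $\mu$ is a filling of the Young diagram of $\mu$ with letters of $\mathcal{A}\cup\mathcal{A}'$ with all rows and columns weakly increasing, unprimed entries weakly increasing along rows and strictly up columns, primed entries strictly increasing along rows and weakly up columns; $HS_\mu(X;Y)=\sum_T\prod x_i^{v_i}\prod y_i^{u_i}$ over SSHT of shape $\mu$, with $v_i,u_i$ the numbers of entries $i$, $i'$. A hook composition tableau (HCT) of shape $\beta$ is a filling $F$ with letters of $\mathcal{A}\cup\mathcal{A}'$ such that rows weakly increase; unprimed entries weakly and primed strictly increase along rows; in the leftmost column unprimed entries strictly and primed weakly increase bottom to top; and for $1\le i<j\le r$, $1\le n<m$: (a) if $\hat F(i,n+1)\in\mathcal{A}$ and $\hat F(i,n+1)\ge\hat F(j,n)$ then $\hat F(i,n+1)>\hat F(j,n+1)$; (b) if $\hat F(i,n+1)\in\mathcal{A}'$ and $\hat F(i,n+1)>\hat F(j,n)$ then $\hat F(i,n+1)\ge\hat F(j,n+1)$. $\mathcal{HQ}_\beta(X;Y)=\sum_F\prod x_i^{v_i}\prod y_i^{u_i}$ over HCT of shape $\beta$. *)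

(* Defs.v *)
From HB Require Import structures.
From mathcomp Require Import all_boot all_order all_algebra.
From mathcomp Require Import finmap.
From mathcomp Require Import boolp classical_sets cardinality fsbigop.
From mathcomp Require Import -(notations) monalg.
From mathcomp Require Import mpoly.

Set Implicit Arguments.
Unset Strict Implicit.
Unset Printing Implicit Defensive.

Import Order.TTheory GRing.Theory.
Local Open Scope ring_scope.
Local Open Scope classical_set_scope.

(** Compositions and partitions are sequences of positive integers. *)
Definition is_composition (b : seq nat) : bool := all (leq 1) b.

Definition is_partition (mu : seq nat) : bool := sorted geq mu && all (leq 1) mu.

Definition subcomp (a b : seq nat) : bool :=
  (size a <= size b)%N &&
  [forall i : 'I_(size a), (nth 0 a i <= nth 0 b i)%N].

Definition max_part (b : seq nat) : nat := \max_(p <- b) p.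

(** A filling is the list of its rows from bottom to top (French notation), each
    row read from left to right; [shape F] is then its shape.  Rows and columns
    are numbered from 0. *)
Section Fillings.
Context {disp : Order.disp_t} {T : orderType disp}.
Implicit Types (F : seq (seq T)) (x y : option T).

Definition column F (j : nat) : seq T := pmap (fun row => onth row j) F.

(** The array with missing cells filled with infinity, the latter being [None]. *)
Definition hat F (i j : nat) : option T := onth (nth [::] F i) j.

Definition le_hat x y : bool :=
  match x, y with
  | _, None => true
  | None, Some _ => false
  | Some a, Some b => (a <= b)%O
  end.

Definition lt_hat x y : bool := ~~ le_hat y x.

End Fillings.

(** Tableaux with positive integer entries. *)
Definition positive_entries (T : seq (seq nat)) : bool := all (all (leq 1)) T.

Definition SSYCT (b : seq nat) (T : seq (seq nat)) : Prop :=
  [/\ shape T = b, positive_entries T, all (sorted <=%O) T,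
      sorted <%O (column T 0) &
      forall i j n : nat, (i < j < size b)%N -> (n.+1 < max_part b)%N ->
        hat T i n.+1 != None ->
        le_hat (hat T j n) (hat T i n.+1) ->
        lt_hat (hat T j n.+1) (hat T i n.+1)].

Definition SSYT (mu : seq nat) (T : seq (seq nat)) : Prop :=
  [/\ shape T = mu, positive_entries T, all (sorted <=%O) T &
      forall j : nat, sorted <%O (column T j)].

(** Formal power series in [x_1, x_2, ...] with integer coefficients, as
    functions from monomials to coefficients.  The variables of [{cmonom nat}]
    are indexed from 0, and [x_0] never occurs in [CS] and [schur] since the
    entries of tableaux are positive. *)
Definition series := cmonom nat -> int.

Definition series_mul (f g : series) : series := fun m =>
  \sum_(p \in [set p : cmonom nat * cmonom nat |
                mmul p.1 p.2 = m]) f p.1 * g p.2.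

Definition series_monom (T : seq (seq nat)) : cmonom nat :=
  \big[mmul/mone]_(c <- flatten T) ucm c.

(** The sum of the monomials of all elements of [S], coefficientwise.  The sets
    used below have only finitely many elements with a given monomial. *)
Definition tableau_series (S : set (seq (seq nat))) : series := fun m =>
  \sum_(T \in S) ((series_monom T == m)%:R : int).

Definition CS (b : seq nat) : series := tableau_series [set T | SSYCT b T].

Definition schur (mu : seq nat) : series := tableau_series [set T | SSYT mu T].

(** The alphabet 1 < ... < k < 1' < ... < l' is ['I_(k + l)] with its natural
    order: [lshift l i] is the unprimed letter i+1 and [rshift k j] is the primed
    letter (j+1)'. *)
Section Hook.
Variables k l : nat.
Implicit Types (c d : 'I_(k + l)) (F : seq (seq 'I_(k + l))).

Definition unprimed c : bool := (c < k)%N.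
Definition primed c : bool := ~~ unprimed c.

Definition hook_row c d : bool := (c <= d)%O && ((c == d) ==> unprimed c).
Definition hook_col c d : bool := (c <= d)%O && ((c == d) ==> primed c).

Definition SSHT (mu : seq nat) F : Prop :=
  [/\ shape F = mu, all (sorted hook_row) F &
      forall j : nat, sorted hook_col (column F j)].

Definition HCT (b : seq nat) F : Prop :=
  [/\ shape F = b, all (sorted hook_row) F, sorted hook_col (column F 0) &
      forall i j n : nat, (i < j < size b)%N -> (n.+1 < max_part b)%N ->
        forall c, hat F i n.+1 = Some c ->
        (unprimed c -> le_hat (hat F j n) (Some c) ->
           lt_hat (hat F j n.+1) (Some c)) /\
        (primed c -> lt_hat (hat F j n) (Some c) ->
           le_hat (hat F j n.+1) (Some c))].

(** Correspondingly, ['X_(lshift l i)] is the variable x_(i+1) and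
    ['X_(rshift k j)] is the variable y_(j+1). *)
Definition hook_monom F : {mpoly int[k + l]} := \prod_(c <- flatten F) 'X_c.

Definition HS (mu : seq nat) : {mpoly int[k + l]} :=
  \sum_(F \in [set F | SSHT mu F]) hook_monom F.

Definition HQ (b : seq nat) : {mpoly int[k + l]} :=
  \sum_(F \in [set F | HCT b F]) hook_monom F.

End Hook.

(* Main.v *)
Require Import Defs.
From mathcomp Require Import all_boot all_order all_algebra.
From mathcomp Require Import zify ring.
From mathcomp Require Import finmap.
From mathcomp Require Import -(notations) monalg.
From mathcomp Require Import mpoly.
From mathcomp Require Import boolp classical_sets fsbigop.

Set Implicit Arguments.
Unset Strict Implicit.
Unset Printing Implicit Defensive.

Import Order.TTheory GRing.Theory.

Local Open Scope ring_scope.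

(* Remove the largest letter from a tableau: the cells it occupies form a
   horizontal strip if it is unprimed and a vertical strip if it is primed.  Hence
   HQ and HS are obtained by applying, one letter after the other, operators H(x)
   and V(y) on functions of the shape, and these make sense for any word of primed
   and unprimed letters.  The hypothesis, evaluated in finitely many variables, is
   the identity for words without primed letters.  A sign-reversing involution
   gives H(-y) V(y) = 1.  Now H(-y) - 1 is locally nilpotent, so replacing a letter V(y) by n copies of H(-y) makes both
   sides of the identity polynomial in n; they agree for all natural n, hence at
   n = -1, which is V(y).  Induction on the number of primed letters concludes. *)

(** * Polynomial sequences, described by vanishing iterated differences *)

Section FiniteDifferences.
Variable R : comNzRingType.
Implicit Types (f g : nat -> R) (d e n : nat).

(** By Newton's formula these are the [R]-combinations of the binomial coefficients of [n] over [i]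
    for [i < d]: polynomial sequences of degree below [d], in a form that asks for no division in
    [R]. *)
Fixpoint pseq d f : Prop :=
  if d is d'.+1 then pseq d' (fun n => f n.+1 - f n) else forall n, f n = 0.

Lemma eq_pseq d f g : f =1 g -> pseq d f -> pseq d g.
Proof.
elim: d f g => [|d IH] f g fg /= Hf; first by move=> n; rewrite -fg.
by apply: IH Hf => n; rewrite !fg.
Qed.

Lemma pseq0 d : pseq d (fun=> 0).
Proof. by elim: d => //= d IH; apply: eq_pseq IH => n; rewrite subr0. Qed.

Lemma pseqD d f g : pseq d f -> pseq d g -> pseq d (fun n => f n + g n).
Proof.
elim: d f g => [|d IH] f g /= Hf Hg; first by move=> n; rewrite Hf Hg addr0.
by apply: eq_pseq (IH _ _ Hf Hg) => n; ring.
Qed.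

Lemma pseqZ d a f : pseq d f -> pseq d (fun n => a * f n).
Proof.
elim: d f => [|d IH] f /= Hf; first by move=> n; rewrite Hf mulr0.
by apply: eq_pseq (IH _ Hf) => n; rewrite mulrBr.
Qed.

Lemma pseq_sum d (I : Type) (r : seq I) (P : pred I) (F : I -> nat -> R) :
  (forall i, P i -> pseq d (F i)) -> pseq d (fun n => \sum_(i <- r | P i) F i n).
Proof.
move=> HF; elim: r => [|i r IH].
  by apply: eq_pseq (pseq0 d) => n; rewrite big_nil.
have [Pi|nPi] := boolP (P i).
  by apply: eq_pseq (pseqD (HF i Pi) IH) => n; rewrite big_cons Pi.
by apply: eq_pseq IH => n; rewrite big_cons (negPf nPi).
Qed.

Lemma pseqS d f : pseq d f -> pseq d.+1 f.
Proof.
elim: d f => [|d IH] f; last by move=> Hf; apply: IH Hf.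
by move=> Hf n; rewrite !Hf subr0.
Qed.

Lemma leq_pseq d e f : (d <= e)%N -> pseq d f -> pseq e f.
Proof.
move=> /subnK <-; elim: (e - d)%N => // k IH Hf; rewrite addSn.
exact/pseqS/IH.
Qed.

Lemma pseq_shift d f : pseq d f -> pseq d (fun n => f n.+1).
Proof. by elim: d f => [|d IH] f /= Hf; [move=> n; apply: Hf | apply: IH Hf]. Qed.

(** Discrete Leibniz rule: the difference of the product at [n] is the difference of [f] times
    [g n.+1], plus [f n] times the difference of [g]. *)
Lemma pseqM d e f g : pseq d f -> pseq e g -> pseq (d + e) (fun n => f n * g n).
Proof.
elim: d e f g => [|d IHd] e f g.
  by move=> Hf _; apply: leq_pseq (leq0n _) _ => n; rewrite Hf mul0r.
elim: e f g => [|e IHe] f g Hf Hg.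
  by apply: leq_pseq (leq0n _) _ => n; rewrite Hg mulr0.
rewrite addSn /=.
have H1 := IHd _ _ _ Hf (pseq_shift Hg).
have H2 := IHe _ _ Hf Hg; rewrite addSn -addnS in H2.
by apply: eq_pseq (pseqD H1 H2) => n; ring.
Qed.

(** The difference of [f] also vanishes from 1 on, hence at 0 by induction on [d], and so [f 0]
    equals [f 1]. The index 0 will stand for the exponent -1 of an unprimed letter. *)
Lemma pseq_eq0 d f : pseq d f -> (forall n, f n.+1 = 0) -> f 0%N = 0.
Proof.
elim: d f => [|d IH] f /= Hf f0; first exact: Hf.
have := IH _ Hf; rewrite f0 => /(_ _)/eqP; rewrite sub0r oppr_eq0 => H.
by apply/eqP; apply: H => n; rewrite !f0 subr0.
Qed.

End FiniteDifferences.

(** * Strips between shapes and the sign-reversing involution *)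

Section Strips.
Local Open Scope nat_scope.

(** The length is kept, an emptied row having length 0, so that rows keep their numbers when letters
    are removed. *)
Fixpoint subs (b : seq nat) : seq (seq nat) :=
  if b is x :: b' then [seq y :: g | y <- iota 0 x.+1, g <- subs b']
  else [:: [::]].

Lemma subs_cons x b :
  subs (x :: b) = [seq y :: g | y <- iota 0 x.+1, g <- subs b].
Proof. by []. Qed.

Lemma subsP b g :
  reflect (size g = size b /\ forall i, (nth 0 g i <= nth 0 b i)%N)
          (g \in subs b).
Proof.
elim: b g => [|x b IH] g.
  rewrite inE; apply: (iffP eqP) => [->|[/size0nil]]; first by split.
  by [].
rewrite subs_cons; apply: (iffP allpairsPdep) => [[y [h [Hy /IH[sz le_hb] ->]]]|[]].
  split; first by rewrite /= sz.
  by move: Hy; rewrite mem_iota => Hy [|i] /=; [lia | apply: le_hb].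
case: g => [|y g] // [sz] le_gb; exists y, g; split => //.
  by rewrite mem_iota; have := le_gb 0%N; rewrite /=; lia.
by apply/IH; split => // i; have := le_gb i.+1.
Qed.

Lemma subs_uniq b : uniq (subs b).
Proof.
elim: b => // x b IH; rewrite subs_cons; apply: allpairs_uniq => //; first exact: (iota_uniq 0 x.+1).
by move=> [y g] [y' g'] _ _ /= [-> ->].
Qed.

Lemma subs_refl b : b \in subs b.
Proof. exact/subsP. Qed.

Lemma subs_trans b g h : h \in subs g -> g \in subs b -> h \in subs b.
Proof.
move=> /subsP[sz1 le1] /subsP[sz2 le2]; apply/subsP; split; first by rewrite sz1.
by move=> i; apply: leq_trans (le2 i).
Qed.

Lemma leq_sumn_subs b g : g \in subs b -> (sumn g <= sumn b)%N.
Proof.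
elim: b g => [|x b IH] g; first by rewrite inE => /eqP->.
rewrite subs_cons => /allpairsPdep[y [h [Hy /IH sz ->]]] /=.
by move: Hy; rewrite mem_iota; lia.
Qed.

Lemma eq_sumn_subs b g : g \in subs b -> sumn g = sumn b -> g = b.
Proof.
elim: b g => [|x b IH] g; first by rewrite inE => /eqP->.
rewrite subs_cons => /allpairsPdep[y [h [Hy Hh ->]]] /= Es.
have := leq_sumn_subs Hh; move: Hy; rewrite mem_iota => Hy ?.
have -> : y = x by lia.
by rewrite (IH _ Hh) //; lia.
Qed.

Lemma subs_anti b g : g \in subs b -> b \in subs g -> g = b.
Proof.
move=> Hg Hb; apply: eq_sumn_subs => //.
by apply/eqP; rewrite eqn_leq !leq_sumn_subs.
Qed.

Variable s : nat -> bool.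

(* The condition that a cell of column [q] filled with the largest letter
   imposes on a higher row, whose length is [x] with and [y] without that
   letter.  Columns satisfying [s] behave as in partition-shaped tableaux, the
   others as in composition tableaux. *)
Definition strip_rule (p : bool) (q x y : nat) : bool :=
  if s q then ((if p then y else x) <= q)%N
  else if p then (y < q)%N || (q < x)%N else (x < q)%N || (q < y)%N.

Definition strip (p : bool) (b g : seq nat) : Prop :=
  (p -> forall i, (nth 0 b i <= (nth 0 g i).+1)%N) /\
  forall i j q, (i < j)%N -> (nth 0 g i <= q < nth 0 b i)%N ->
    strip_rule p q (nth 0 b j) (nth 0 g j).

Lemma strip_refl p b : strip p b b.
Proof. by split => [_ i|i j q _]; [exact: leqnSn | lia]. Qed.

(** This moves the cell of row [i] in column [q] between the horizontal strip [b / g] and the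
    vertical strip [g / c]. *)
Definition toggle (q i : nat) (g : seq nat) : seq nat :=
  set_nth 0 g i (if nth 0 g i == q then q.+1
                 else if nth 0 g i == q.+1 then q else nth 0 g i).

Lemma toggleK q i g : (i < size g)%N -> toggle q i (toggle q i g) = g.
Proof.
move=> lt_ig; apply: (@eq_from_nth _ 0%N).
  by rewrite !size_set_nth; lia.
move=> j _; rewrite /toggle !nth_set_nth /= nth_set_nth /= eqxx.
by case: (j =P i) => [->|//]; repeat case: eqP => //=; lia.
Qed.

(* The row in which the sign-reversing involution acts: among the leftmost cells
   of [b / c], the highest or the lowest one. *)
Lemma toggle_row b c : c \in subs b -> c != b ->
  exists2 i, (nth 0 c i < nth 0 b i)%N &
    forall j, (nth 0 c j < nth 0 b j)%N ->
      (nth 0 c i <= nth 0 c j)%N /\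
      (nth 0 c j = nth 0 c i -> if s (nth 0 c i) then (j <= i)%N else (i <= j)%N).
Proof.
move=> cb neq.
pose P q := has (fun i => (nth 0 c i == q) && (q < nth 0 b i)%N) (iota 0 (size b)).
have Pin i : (nth 0 c i < nth 0 b i)%N -> P (nth 0 c i).
  move=> lt; apply/hasP; exists i; last by rewrite eqxx.
  rewrite mem_iota /= add0n ltnNge; apply/negP => le.
  by rewrite [in X in (_ < X)%N]nth_default in lt.
have exP : exists q, P q.
  have [i lti] : exists i, (nth 0 c i < nth 0 b i)%N.
    apply: contrapT => no; case/eqP: neq; case/subsP: cb => sz le.
    apply: (@eq_from_nth _ 0%N) => // i _; have := le i.
    by rewrite leq_eqVlt => /orP[/eqP//|lt]; case: no; exists i.
  by exists (nth 0 c i); apply: Pin.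
case: (ex_minnP exP) => q /hasP[i0 _ /andP[/eqP ci0 bi0]] minq.
pose Q i := (nth 0 c i == q) && (q < nth 0 b i)%N.
have exQ : exists i, Q i by exists i0; rewrite /Q ci0 eqxx.
have ubQ i : Q i -> (i <= size b)%N.
  move=> /andP[_]; case: (leqP i (size b)) => // lt; rewrite nth_default //; lia.
have [i Qi Hi] : exists2 i, Q i &
    forall j, Q j -> if s q then (j <= i)%N else (i <= j)%N.
  case: (s q); first by case: (ex_maxnP exQ ubQ) => i Qi ?; exists i.
  by case: (ex_minnP exQ) => i Qi ?; exists i.
case/andP: Qi => /eqP ci bi; exists i; first by rewrite ci.
move=> j ltj; rewrite ci; split; first by apply: minq; apply: Pin.
by move=> cj; apply: Hi; rewrite /Q cj eqxx -cj.
Qed.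

(** These are the intermediate shapes behind the coefficient of [phi c] in H(-t) V(t) [phi] at
    [b]. *)
Definition interlaced b c g :=
  [&& g \in subs b, c \in subs g, `[< strip false b g >] & `[< strip true g c >]].

(** No cell of [b / c] lies left of column [q]. If [s q] holds, none in column [q] lies above row
    [i], so the two strip rules for the toggled cell against higher rows agree. Otherwise none in
    column [q] lies below row [i], so no rule imposed on row [i] notices the change. *)
Lemma interlaced_toggle b c g i :
  (nth 0 c i < nth 0 b i)%N ->
  (forall j, (nth 0 c j < nth 0 b j)%N ->
      (nth 0 c i <= nth 0 c j)%N /\
      (nth 0 c j = nth 0 c i -> if s (nth 0 c i) then (j <= i)%N else (i <= j)%N)) ->
  interlaced b c g -> interlaced b c (toggle (nth 0 c i) i g).
Proof.
set q := nth 0 c i => lt_q Hmin /and4P[/subsP[szg gb] /subsP[szc cg]].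
move=> /asboolP[_ Hst] /asboolP[/(_ isT) vle Vst].
have lt_i : (i < size g)%N.
  by rewrite ltnNge; apply/negP => le; rewrite [in X in (_ < X)%N]nth_default // -szg in lt_q.
(* A vertical strip has at most one cell in each row. *)
have gi : (nth 0 g i = q \/ nth 0 g i = q.+1)%N.
  by have := cg i; have := vle i; rewrite -/q; lia.
have hE j : nth 0 (toggle q i g) j =
    if j == i then (if nth 0 g i == q then q.+1 else q) else nth 0 g j.
  rewrite nth_set_nth /=; case: (j =P i) => // _; rewrite -/q.
  by case: gi => ->; rewrite ?eqxx // (gtn_eqF (ltnSn q)).
have szh : size (toggle q i g) = size g by rewrite size_set_nth; apply/maxn_idPr.
set h := toggle q i g in hE szh *.
have Hrow j : (nth 0 c j <= nth 0 g j <= nth 0 b j)%N by rewrite cg gb.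
apply/and4P; split.
- apply/subsP; split; first by rewrite szh.
  by move=> j; rewrite hE; case: eqP => [->|_]; [case: eqP; lia | apply: gb].
- apply/subsP; split; first by rewrite szh.
  by move=> j; rewrite hE; case: eqP => [->|_]; [rewrite -/q; case: eqP; lia | apply: cg].
- apply/asboolP; split=> // i' j q' lt_ij; rewrite !hE.
  case: (i' =P i) => [Ei|ne_i] cell.
    subst i'; have /negPf-> : j != i by lia.
    have [le|lt] := leqP (nth 0 g i) q'; first by apply: (Hst i); lia.
    have [E1 E2] : nth 0 g i = q.+1 /\ q' = q by case: eqP cell; lia.
    have := Vst i j q lt_ij; rewrite -/q E1 E2 leqnn ltnSn => /(_ isT).
    have := Hmin j; rewrite /strip_rule /= -/q; have := Hrow j.
    by case: (s q) => /=; lia.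
  have := Hst i' j q' lt_ij cell.
  case: (j =P i) => // Ej; subst j; rewrite /strip_rule.
  have := Hmin i'; have := Hrow i'; rewrite -/q.
  case sq: (s q') => //.
  (* Here [s q'] fails; [q' = q] would give a cell of column [q] below row [i], against the choice
     of the lowest row. *)
  case: (q' =P q) => [Eq|]; last by case: eqP; lia.
  by rewrite -Eq sq; case: eqP => /=; lia.
apply/asboolP; split=> [_ j|i' j q' lt_ij].
  rewrite hE; case: eqP => [->|_]; last exact: vle.
  by rewrite -/q; case: eqP; lia.
rewrite !hE; case: (i' =P i) => [Ei|ne_i] cell.
  subst i'; have /negPf-> : j != i by lia.
  have Eq : q' = q by move: cell; rewrite -/q; case: eqP; lia.
  rewrite Eq.
  case: (gi) => E1; last by apply: (Vst i); rewrite // -/q; lia.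
  have := Hst i j q lt_ij; rewrite E1 leqnn lt_q => /(_ isT).
  by have := Hrow j; rewrite /strip_rule /=; case: (s q); lia.
have := Vst i' j q' lt_ij cell.
case: (j =P i) => // Ej; subst j; rewrite /strip_rule -/q.
have := Hmin i'; have := Hrow i'; rewrite -/q.
case sq: (s q') => //.
case: (q' =P q) => [Eq|]; last by case: eqP; lia.
by rewrite -Eq sq; case: eqP => /=; lia.
Qed.

(** For [c = b] only [g = b] contributes. Otherwise toggling changes the number of cells of [g] by
    one, so the sum is its own opposite; over [int] this forces it to be 0, which characteristic 2
    would not allow. *)
Lemma sum_interlaced b c : c \in subs b ->
  (\sum_(g <- subs b | interlaced b c g) (-1) ^+ (sumn b - sumn g) = (c == b)%:R :> int)%R.
Proof.
move=> cb; case: (c =P b) => [->|/eqP neq].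
  rewrite big_mkcond (bigD1_seq b) ?subs_uniq ?subs_refl //= big1 ?addr0 => [|g neq].
    rewrite subnn ifT //; apply/and4P.
    by split; rewrite ?subs_refl //; apply/asboolP/strip_refl.
  case: ifP => // /and4P[gb bg _ _].
  by rewrite (subs_anti gb bg) eqxx in neq.
have [i lt_i Hi] := toggle_row cb neq.
set q := nth 0 c i in lt_i Hi.
have szi : (i < size b)%N.
  by rewrite ltnNge; apply/negP => le; rewrite [in X in (_ < X)%N]nth_default in lt_i.
have tK g : g \in subs b -> toggle q i (toggle q i g) = g.
  by move=> /subsP[sz _]; rewrite toggleK // sz.
have tin g : interlaced b c g -> interlaced b c (toggle q i g).
  exact: interlaced_toggle.
have tsgn g : interlaced b c g ->
    ((-1) ^+ (sumn b - sumn (toggle q i g)) = - (-1) ^+ (sumn b - sumn g) :> int)%R.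
  move=> Ig; have Ih := tin g Ig.
  case/and4P: Ig => gb cg _ /asboolP[/(_ isT i) le1 _].
  have le2 : (q <= nth 0 g i)%N by case/subsP: cg => _; apply.
  have := leq_sumn_subs gb; case/andP: Ih => /leq_sumn_subs.
  rewrite -/q in le1.
  have lti : i < size g by case/subsP: gb => ->.
  have := sumn_set_nth_ltn 0 (if nth 0 g i == q then q.+1
                 else if nth 0 g i == q.+1 then q else nth 0 g i) lti.
  rewrite -/(toggle q i g).
  have leg : nth 0 g i <= sumn g.
    rewrite -[in sumn g](cat_take_drop i g) (drop_nth 0 lti) sumn_cat /=; lia.
  set G := nth 0 g i in le1 le2 leg *; move=> E L1 _ L2.
  have [E1|E1] : sumn (toggle q i g) = (sumn g).+1 \/ (sumn (toggle q i g)).+1 = sumn g.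
    - by move: E; case: eqP => ?; [lia | case: eqP => ?; lia].
    - have -> : (sumn b - sumn g = (sumn b - sumn (toggle q i g)).+1)%N by lia.
      by rewrite exprS mulN1r opprK.
  have -> : (sumn b - sumn (toggle q i g) = (sumn b - sumn g).+1)%N by lia.
  by rewrite exprS mulN1r.
set S := (\sum_(g <- _ | _) _)%R.
suff : (S = - S)%R by lia.
rewrite {1}/S -sumrN.
pose V := [seq g <- subs b | interlaced b c g].
have perm : perm_eq V [seq toggle q i g | g <- V].
  have inV g : g \in V = interlaced b c g.
    by rewrite mem_filter andb_idr // => /and4P[].
  apply: uniq_perm; first by rewrite filter_uniq ?subs_uniq.
    rewrite map_inj_in_uniq ?filter_uniq ?subs_uniq // => x y.
    rewrite !inV => /and4P[xb _ _ _] /and4P[yb _ _ _] E.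
    by rewrite -(tK x xb) E tK.
  move=> g; rewrite inV; apply/idP/mapP => [Ig|[h Hh ->]]; last by apply: tin; rewrite -inV.
  exists (toggle q i g); first by rewrite inV tin.
  by rewrite tK //; case/and4P: Ig.
rewrite -big_filter -/V (perm_big _ perm) big_map -[RHS]big_filter -/V /=.
rewrite big_seq_cond [RHS]big_seq_cond; apply: eq_bigr => g.
by rewrite mem_filter andbT => /andP[/tsgn].
Qed.

End Strips.

(** * The operators H and V, words of letters, and polynomial dependence on repeated letters *)

Section StripOperators.
Variables (R : comNzRingType) (s : nat -> bool).
Implicit Types (p : bool) (t : R) (phi : seq nat -> R) (b g : seq nat).

(** This is H(t) for [p = false] and V(t) for [p = true]. *)
Definition strip_op p t phi b : R :=
  \sum_(g <- subs b | `[< strip s p b g >]) t ^+ (sumn b - sumn g) * phi g.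

Lemma eq_strip_op p t phi psi b : phi =1 psi -> strip_op p t phi b = strip_op p t psi b.
Proof. by move=> E; apply: eq_bigr => g _; rewrite E. Qed.

(** Only [g = b] survives, with the power [0 ^+ 0 = 1]. This serves to discard the letter 0, which
    is absent from tableaux with positive entries. *)
Lemma strip_op0 p phi b : strip_op p 0 phi b = phi b.
Proof.
rewrite /strip_op big_mkcond (bigD1_seq b) ?subs_uniq ?subs_refl //=.
rewrite ifT; last exact/asboolP/strip_refl.
rewrite subnn expr0 mul1r big_seq_cond big1 ?addr0 // => g /andP[gb neq].
case: ifP => // _.
have lt : (sumn g < sumn b)%N.
  rewrite ltn_neqAle leq_sumn_subs // andbT.
  by apply: contra neq => /eqP/(eq_sumn_subs gb)->.
by rewrite -(subnSK lt) exprS !mul0r.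
Qed.

Lemma big_subs b g (P : pred (seq nat)) (F : seq nat -> R) : g \in subs b ->
  \sum_(c <- subs g | P c) F c = \sum_(c <- subs b | (c \in subs g) && P c) F c.
Proof.
move=> gb; rewrite -[LHS]big_filter -[RHS]big_filter; apply: perm_big.
apply: uniq_perm; rewrite ?filter_uniq ?subs_uniq // => c.
rewrite !mem_filter; case: (boolP (c \in subs g)) => [cg|]; last by rewrite andbF.
by rewrite (subs_trans cg gb) andbT.
Qed.

(* Generating functions of horizontal and vertical strips are inverse to each
   other up to the sign of the variable, as [h(-t) e(t) = 1] for symmetric
   functions. *)
Lemma strip_opK t phi b : strip_op false (- t) (strip_op true t phi) b = phi b.
Proof.
rewrite {1}/strip_op.
transitivity (\sum_(g <- subs b | `[< strip s false b g >])
  \sum_(c <- subs b | (c \in subs g) && `[< strip s true g c >])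
    (-1) ^+ (sumn b - sumn g) * (t ^+ (sumn b - sumn c) * phi c)).
  rewrite big_seq_cond [RHS]big_seq_cond; apply: eq_bigr => g /andP[gb _].
  rewrite /strip_op (big_subs _ _ gb) mulr_sumr; apply: eq_bigr => c /andP[cg _].
  rewrite (exprNn t) -!mulrA; congr (_ * _); rewrite !mulrA -exprD.
  by rewrite addnBA ?leq_sumn_subs // subnK // leq_sumn_subs.
rewrite (exchange_big_dep xpredT) //=.
transitivity (\sum_(c <- subs b) (c == b)%:R * (t ^+ (sumn b - sumn c) * phi c)).
  rewrite big_seq [RHS]big_seq; apply: eq_bigr => c cb.
  rewrite -mulr_suml; congr (_ * _).
  rewrite -(rmorph_nat (intmul 1)) -(sum_interlaced s cb) rmorph_sum /=.
  rewrite big_seq_cond [RHS]big_seq_cond; apply: eq_big => [g|g _].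
    by rewrite /interlaced; case: (g \in subs b) => //=; rewrite andbCA.
  by rewrite rmorphXn rmorphN1.
rewrite (bigD1_seq b) ?subs_uniq ?subs_refl //= big1 ?addr0; last first.
  by move=> c /negPf->; rewrite mul0r.
by rewrite eqxx mul1r subnn mul1r.
Qed.

(* The head of the word is the largest letter. *)
Definition run (w : seq (bool * R)) : seq nat -> R :=
  foldr (fun l => strip_op l.1 l.2) (fun b => (all (eq_op 0%N) b)%:R) w.

Lemma run_cancel w1 t w2 b :
  run (w1 ++ (false, - t) :: (true, t) :: w2) b = run (w1 ++ w2) b.
Proof.
elim: w1 b => [|l w1 IH] b /=; first exact: strip_opK.
exact: eq_strip_op.
Qed.

(** One more copy of the letter applies H(t) once more, and H(t) - 1 only reaches shapes with fewer
    cells than [b]; induction on the number of cells bounds the degree. The prefix [w1] takes linear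
    combinations, independent of [n], of values at subshapes. *)
Lemma pseq_run w1 t w2 b :
  pseq (sumn b).+1 (fun n => run (w1 ++ nseq n (false, t) ++ w2) b).
Proof.
elim: w1 b => [|[p u] w1 IH] b.
  under eq_fun do rewrite cat0s; have [m] := ubnP (sumn b); elim: m b => // m IH b lt_bm.
  rewrite /=; pose P g := (g != b) && `[< strip s false b g >].
  pose F n g := t ^+ (sumn b - sumn g) * run (nseq n (false, t) ++ w2) g.
  apply: (@eq_pseq _ _ (fun n => \sum_(g <- [seq g <- subs b | P g]) F n g)).
    move=> n; rewrite /= [X in _ = X - _]/strip_op [in RHS]big_mkcond.
    rewrite [in RHS](bigD1_seq b) ?subs_uniq ?subs_refl //=.
    rewrite ifT; last exact/asboolP/strip_refl.
    rewrite subnn mul1r addrAC subrr add0r big_filter [RHS]big_mkcond.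
    rewrite [LHS]big_mkcond; apply: eq_bigr => g _; rewrite /P.
    by case: (g != b).
  rewrite (_ : (fun n => _) =
      (fun n => \sum_(g <- [seq g <- subs b | P g] | g \in [seq g <- subs b | P g]) F n g)); last first.
    by apply/funext => n; rewrite big_seq.
  apply: pseq_sum => g; rewrite mem_filter => /andP[/andP[neq _] gb].
  have lt : (sumn g < sumn b)%N.
    rewrite ltn_neqAle leq_sumn_subs // andbT.
    by apply: contra neq => /eqP/(eq_sumn_subs gb)->.
  apply: pseqZ; apply: (leq_pseq lt); apply: IH; exact: leq_trans lt _.
rewrite (_ : (fun n => run _ b) = (fun n => \sum_(g <- subs b |
    (g \in subs b) && `[< strip s p b g >])
    u ^+ (sumn b - sumn g) * run (w1 ++ nseq n (false, t) ++ w2) g)); last first.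
  by apply/funext => n; rewrite -big_seq_cond.
apply: pseq_sum => g /andP[gb _]; apply: pseqZ; apply: leq_pseq (IH g).
by rewrite ltnS leq_sumn_subs.
Qed.

End StripOperators.

(* As a function of [n], the value on a word containing [(false, - t)] exactly
   [n] times in a row is polynomial; by [run_cancel] a letter [(true, t)]
   amounts to [n = -1], so identities between the values on words without primed
   letters extend to all words. *)
Lemma run_superization (R : comNzRingType) (s1 s2 : nat -> bool)
    (a m : seq nat) (B : seq (seq nat)) (P : pred (seq nat)) (A : seq nat -> R) :
  (forall w, all (fun l => ~~ l.1) w ->
     run s1 w a * run s2 w m = \sum_(b <- B | P b) A b * run s1 w b) ->
  forall w, run s1 w a * run s2 w m = \sum_(b <- B | P b) A b * run s1 w b.
Proof.
move=> H0 w; have [n] := ubnP (count (fun l => l.1) w).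
elim: n w => // n IH w lt_wn.
case: (boolP (has (fun l => l.1) w)) => [|]; last by rewrite -all_predC => /H0.
move=> hw; move: lt_wn; case/split_find: hw => -[p t] w1 w2 /= -> _.
rewrite cat_rcons count_cat /= => lt_wn.
(* [W 0] is the given word; since [(true, t)] counts as -1 copies of [(false, - t)], the exponent is
   shifted by one. *)
pose W n := w1 ++ nseq n (false, - t) ++ (true, t) :: w2.
pose D n := run s1 (W n) a * run s2 (W n) m +
  (-1) * \sum_(b <- B | P b) A b * run s1 (W n) b.
have [d1 [d2 Dp]] : exists d1 d2, pseq (d1 + d2) D.
  (* A degree bound large enough for the product and for every term of the sum at once. *)
  pose d2 := (sumn m + \max_(b <- B) (sumn b).+1)%N.
  exists (sumn a).+1, d2.+1; apply: pseqD.
    apply: pseqM; first exact: pseq_run.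
    by apply: leq_pseq (pseq_run _ _ _ _ _); rewrite ltnS leq_addr.
  apply: pseqZ; rewrite (_ : (fun n => _) =
      (fun n => \sum_(b <- B | (b \in B) && P b) A b * run s1 (W n) b)); last first.
    by apply/funext => k; rewrite big_seq_cond.
  apply: pseq_sum => b /andP[bB _]; apply: pseqZ.
  apply: leq_pseq (pseq_run _ _ _ _ _).
  have : ((sumn b).+1 <= \max_(b <- B) (sumn b).+1)%N by exact: leq_bigmax_seq.
  by rewrite /d2; lia.
(* Cancelling one copy of [(false, - t)] against [(true, t)] leaves a word with one primed letter
   fewer, covered by the induction hypothesis. *)
have DS k : D k.+1 = 0.
  have E s' b : run s' (W k.+1) b = run s' ((w1 ++ nseq k (false, - t)) ++ w2) b.
    by rewrite -[RHS](run_cancel _ _ t) /W -addn1 nseqD -!catA.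
  rewrite /D !E (eq_bigr (fun b => A b * run s1 ((w1 ++ nseq k (false, - t)) ++ w2) b)); last first.
    by move=> b _; rewrite E.
  rewrite mulN1r; apply/eqP; rewrite subr_eq0; apply/eqP; apply: IH.
  have c0 : count (fun l : bool * R => l.1) (nseq k (false, - t)) = 0%N.
    by rewrite count_nseq.
  by rewrite !count_cat c0; lia.
by have /eqP := pseq_eq0 Dp DS; rewrite /D mulN1r subr_eq0 => /eqP.
Qed.

(** * Tableaux as chains of strips *)

Section Tableaux.
Local Open Scope nat_scope.
Variables (s p : nat -> bool).
Hypothesis s0 : s 0.
Implicit Types (F : seq (seq nat)) (b g r : seq nat) (N : nat).

(* Letters are the integers below [N], those satisfying [p] being primed, and a
   missing cell reads as [N]. *)
Definition entry N F i q := nth N (nth [::] F i) q.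

Definition row_rel c d := (c < d) || (c == d) && ~~ p c.

(** Here [c] is a cell of column [q], while [x] and [y] are the cells of a higher row in columns
    [q.-1] and [q]. The first branch is the column condition, the second the triple condition of
    composition tableaux. *)
Definition cell_rule pc sq c x y :=
  if sq then (if pc then c <= y else c < y)
  else if pc then (x < c) ==> (y <= c) else (x <= c) ==> (y < c).

(** At [q = 0] the truncated [q.-1] is harmless: by [s0] the column branch of [cell_rule] applies,
    and it ignores that argument. *)
Definition tab N b F : Prop :=
  [/\ shape F = b, all (all (fun c => c < N)) F, all (sorted row_rel) F &
      forall i j q, i < j -> entry N F i q < N ->
        cell_rule (p (entry N F i q)) (s q) (entry N F i q)
          (entry N F j q.-1) (entry N F j q)].

Definition ext N b F := [seq x.1 ++ nseq (x.2 - size x.1) N | x <- zip F b].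

Definition below N F := map (filter (fun c => c < N)) F.

Lemma path_row_max N r : path row_rel N r -> all (fun c => c < N.+1) r ->
  r = nseq (size r) N /\ (p N -> r = [::]).
Proof.
elim: r => //= x r IH /andP[Nx pr] /andP[xN /IH H].
move: Nx; rewrite /row_rel ltnNge -ltnS xN /= => /andP[/eqP Ex /negPf ->].
by subst x; case: (H pr) => <-.
Qed.

Lemma row_split N r : sorted row_rel r -> all (fun c => c < N.+1) r ->
  let r' := [seq c <- r | c < N] in
  [/\ r = r' ++ nseq (size r - size r') N, p N -> size r <= (size r').+1 &
      sorted row_rel r'].
Proof.
elim: r => //= x r IH pr /andP[xN rN].
have [lt|ge] := ltnP x N.
  have [E H sr] := IH (path_sorted pr) rN; split => //=.
    by rewrite subSS -E.
  move: pr; rewrite {1}E cat_path => /andP[+ _] => {}pr.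
  exact: pr.
have Ex : x = N by lia.
subst x; have [E H] := path_row_max pr rN.
have -> : [seq c <- r | c < N] = [::].
  by rewrite E; elim: (size r) => //= n ->; rewrite ltnn.
split => //=; first by rewrite -E.
by move=> /H ->.
Qed.

Lemma sorted_row_ext N m r : sorted row_rel r -> all (fun c => c < N) r ->
  (p N -> m <= 1) -> sorted row_rel (r ++ nseq m N).
Proof.
move=> sr rN pm.
have pn k : (p N -> k = 0) -> path row_rel N (nseq k N).
  elim: k => //= k IH pk; have /negPf pN : ~~ p N by apply/negP => /pk.
  by rewrite /row_rel eqxx pN orbT IH // pN.
case: r sr rN => [_ _|x r] /=.
  by case: m pm => //= m pm; apply: pn => /pm; lia.
rewrite cat_path => -> /andP[xN rN] /=; case: m pm => //= m pm.
rewrite pn ?andbT; last by move=> /pm; lia.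
suff lt : last x r < N by rewrite /row_rel lt.
have := mem_last x r; rewrite inE => /orP[/eqP->//|].
by apply: (allP rN).
Qed.

Lemma shape_ext N b F : shape F \in subs b -> shape (ext N b F) = b.
Proof.
elim: F b => [|r F IH] [|x b] //; first by case/subsP.
rewrite subs_cons => /allpairsPdep[y [g [Hy Hg [Ey Eg]]]]; subst y g.
move: Hy; rewrite mem_iota /= => Hy; rewrite size_cat size_nseq.
by congr (_ :: _); [lia | apply: IH].
Qed.

Lemma nth_ext N b F i : size F = size b ->
  nth [::] (ext N b F) i = nth [::] F i ++ nseq (nth 0 b i - size (nth [::] F i)) N.
Proof.
move=> sz; case: (ltnP i (size F)) => H.
  by rewrite (nth_map ([::], 0)) ?size_zip -?sz ?minnn // nth_zip.
by rewrite !nth_default // -?sz // size_map size_zip -sz minnn.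
Qed.

Lemma all_nth_row N F i : all (all (fun c => c < N)) F ->
  all (fun c => c < N) (nth [::] F i).
Proof.
move=> H; case: (ltnP i (size F)) => lt; last by rewrite nth_default.
by apply: (allP H); apply: mem_nth.
Qed.

Lemma entry_lt N F i q : all (all (fun c => c < N)) F ->
  (entry N F i q < N) = (q < size (nth [::] F i)).
Proof.
move=> H; rewrite /entry; case: (ltnP q (size _)) => lt.
  by apply: (allP (all_nth_row i H)); apply: mem_nth.
by rewrite nth_default // ltnn.
Qed.

Lemma entry_ext N b F i q :
  all (all (fun c => c < N)) F -> shape F \in subs b ->
  entry N.+1 (ext N b F) i q =
    if q < nth 0 (shape F) i then entry N F i q
    else if q < nth 0 b i then N else N.+1.
Proof.
move=> FN /subsP[]; rewrite size_map => sz le.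
have := le i; rewrite nth_shape => lei.
rewrite /entry nth_ext // nth_cat; case: ltnP => H; first exact: set_nth_default.
rewrite nth_nseq; case: ltnP => H1; case: ltnP => H2 //; lia.
Qed.

Lemma below_ext N b F : all (all (fun c => c < N)) F -> size F = size b ->
  below N (ext N b F) = F.
Proof.
elim: F b => [|r F IH] [|x b] //= /andP[rN FN] [sz].
rewrite filter_cat; congr (_ :: _); last exact: IH.
rewrite (all_filterP rN) -[RHS]cats0; congr (_ ++ _).
by elim: (_ - _) => //= n ->; rewrite ltnn.
Qed.

(** For an old cell, the extension only changes missing entries into values that are still larger
    than it. For a new cell, the entries of row [j] are below, equal to or above [N] according to
    their column, which turns [cell_rule] into [strip_rule]. *)
Lemma cell_rule_ext N b F i j :
  all (all (fun c => c < N)) F -> shape F \in subs b ->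
  (forall q, entry N.+1 (ext N b F) i q < N.+1 ->
     cell_rule (p (entry N.+1 (ext N b F) i q)) (s q) (entry N.+1 (ext N b F) i q)
       (entry N.+1 (ext N b F) j q.-1) (entry N.+1 (ext N b F) j q)) <->
  (forall q, entry N F i q < N ->
     cell_rule (p (entry N F i q)) (s q) (entry N F i q)
       (entry N F j q.-1) (entry N F j q)) /\
  (forall q, nth 0 (shape F) i <= q < nth 0 b i ->
     strip_rule s (p N) q (nth 0 b j) (nth 0 (shape F) j)).
Proof.
move=> FN Fb.
have le k : nth 0 (shape F) k <= nth 0 b k by case/subsP: Fb.
have eN k q : (entry N F k q < N) = (q < nth 0 (shape F) k).
  by rewrite entry_lt // nth_shape.
have e0 k q : nth 0 (shape F) k <= q -> entry N F k q = N.
  by rewrite nth_shape => H; rewrite /entry nth_default.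
have small q : q < nth 0 (shape F) i ->
    cell_rule (p (entry N.+1 (ext N b F) i q)) (s q) (entry N.+1 (ext N b F) i q)
       (entry N.+1 (ext N b F) j q.-1) (entry N.+1 (ext N b F) j q) =
    cell_rule (p (entry N F i q)) (s q) (entry N F i q)
       (entry N F j q.-1) (entry N F j q).
  move=> lt; rewrite !entry_ext // lt; set c := entry N F i q.
  have lc : c < N by rewrite eN.
  have H k : (if k < nth 0 (shape F) j then entry N F j k
      else if k < nth 0 b j then N else N.+1) = entry N F j k \/
     entry N F j k = N /\ (N <= if k < nth 0 (shape F) j then entry N F j k
      else if k < nth 0 b j then N else N.+1).
    by case: ltnP => [_|/e0->]; [left | right; case: ifP].
  move: (H q) (H q.-1); move: (if q < _ then _ else _) (if q.-1 < _ then _ else _).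
  move=> y x Hy Hx; rewrite /cell_rule.
  by case: (s q); case: (p c); lia.
have large q : nth 0 (shape F) i <= q < nth 0 b i ->
    cell_rule (p (entry N.+1 (ext N b F) i q)) (s q) (entry N.+1 (ext N b F) i q)
       (entry N.+1 (ext N b F) j q.-1) (entry N.+1 (ext N b F) j q) =
    strip_rule s (p N) q (nth 0 b j) (nth 0 (shape F) j).
  move=> /andP[ge lt]; rewrite !entry_ext // (ltnNge q) ge lt /=.
  have := le j; have := eN j q; have := eN j q.-1; rewrite /cell_rule /strip_rule.
  (* Column 0 must be separated, as [q.-1] is the preceding column only for positive [q]. *)
  have : s q \/ 0 < q by case: (q) => [|q']; [left | right].
  move: (nth 0 b j) (nth 0 (shape F) j) (entry N F j q) (entry N F j q.-1) => B G y x.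
  by case: (s q); case: (p N); case: (ltnP q G); case: (ltnP q B);
     case: (ltnP q.-1 G); case: (ltnP q.-1 B); lia.
split=> [H|[H1 H2] q].
  split=> q Hq; last first.
    rewrite -large //; apply: H; case/andP: Hq => ge lt.
    by rewrite entry_ext // (ltnNge q) ge lt /=.
  rewrite eN in Hq; rewrite -small //; apply: H.
  by rewrite entry_ext // Hq ltnS ltnW // eN.
case: (ltnP q (nth 0 (shape F) i)) => [lt _|ge].
  by rewrite small //; apply: H1; rewrite eN.
case: (ltnP q (nth 0 b i)) => [lt _|ge2].
  by rewrite large ?ge //; apply: H2; rewrite ge.
by rewrite entry_ext // (ltnNge q) ge /= (ltnNge q) ge2 /= ltnn.
Qed.

Lemma tab_ext N b F : shape F \in subs b -> strip s (p N) b (shape F) ->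
  tab N (shape F) F -> tab N.+1 b (ext N b F).
Proof.
move=> Fb [st1 st2] [_ FN sF rF]; split; first exact: shape_ext.
- apply/(all_nthP [::]) => i _; case/subsP: (Fb); rewrite size_map => sz _.
  rewrite nth_ext // all_cat; apply/andP; split.
    by apply: sub_all (all_nth_row i FN) => c /ltnW.
  by apply/allP => c; rewrite mem_nseq => /andP[_ /eqP->].
- apply/(all_nthP [::]) => i; rewrite size_map size_zip => lt.
  case/subsP: (Fb); rewrite size_map => sz _.
  rewrite nth_ext //; apply: sorted_row_ext.
  + by move/(all_nthP [::]): sF; apply; move: lt; rewrite sz minnn.
  + exact: all_nth_row.
  + by move=> pN; have := st1 pN i; rewrite nth_shape; lia.
move=> i j q lt_ij; apply: (iffRL (cell_rule_ext i j FN Fb)); split.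
  by move=> q'; apply: rF.
by move=> q' Hq; apply: (st2 i).
Qed.

(** With [tab_ext] this gives the bijection between tableaux and pairs of a strip of largest letters
    and a tableau in the smaller letters. *)
Lemma tab_below N b F : tab N.+1 b F ->
  [/\ shape (below N F) \in subs b, strip s (p N) b (shape (below N F)),
      tab N (shape (below N F)) (below N F) & F = ext N b (below N F)].
Proof.
move=> [Fb FN sF rF].
have Fi i : all (fun c => c < N.+1) (nth [::] F i) by apply: all_nth_row.
have si i : sorted row_rel (nth [::] F i).
  case: (ltnP i (size F)) => lt; last by rewrite nth_default.
  by move/(all_nthP [::]): sF; apply.
have bi i : nth [::] (below N F) i = [seq c <- nth [::] F i | c < N].
  case: (ltnP i (size F)) => lt; first by rewrite (nth_map [::]).
  by rewrite !nth_default ?size_map.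
have szb : size b = size F by rewrite -Fb size_map.
have gb : shape (below N F) \in subs b.
  apply/subsP; split; first by rewrite !size_map szb.
  by move=> i; rewrite -Fb !nth_shape bi size_filter count_size.
have bN : all (all (fun c => c < N)) (below N F).
  by apply/allP => r /mapP[r' _ ->]; apply: filter_all.
have EF : F = ext N b (below N F).
  apply: (@eq_from_nth _ [::]); first by rewrite size_map size_zip size_map szb minnn.
  move=> i _; rewrite nth_ext; last by rewrite size_map szb.
  by rewrite bi -Fb nth_shape; case: (row_split (si i) (Fi i)).
have rule' i j (lt : i < j) := iffLR (cell_rule_ext i j bN gb).
split=> //.
  split=> [pN i|i j q lt_ij Hq].
    rewrite -Fb !nth_shape bi.
    by case: (row_split (si i) (Fi i)) => _ /(_ pN).
  apply: (proj2 (rule' i j lt_ij _)) Hq; rewrite -EF => q'; exact: rF.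
split=> //.
  by apply/allP => r /mapP[r' /(nthP [::])[i _ <-] ->]; case: (row_split (si i) (Fi i)).
move=> i j q lt_ij; apply: (proj1 (rule' i j lt_ij _)); rewrite -EF => q'; exact: rF.
Qed.

(** The enumeration follows the recursion of [run]: the shape left after removing the largest
    letter, then a tableau of that shape. *)
Fixpoint tabs N b : seq (seq (seq nat)) :=
  if N is N'.+1 then
    [seq ext N' b F | g <- [seq g <- subs b | `[< strip s (p N') b g >]], F <- tabs N' g]
  else if all (eq_op 0) b then [:: nseq (size b) [::]] else [::].

Lemma tabsP N b F : reflect (tab N b F) (F \in tabs N b).
Proof.
elim: N b F => [|N IH] b F.
  rewrite /=; apply: (iffP idP).
    case: ifP => // b0; rewrite inE => /eqP ->; split.
    - elim: b b0 => //= x b IH /andP[/eqP<- b0]; congr (_ :: _); exact: IH.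
    - by apply/allP => r; rewrite mem_nseq => /andP[_ /eqP->].
    - by apply/allP => r; rewrite mem_nseq => /andP[_ /eqP->].
    by move=> i j q; rewrite ltn0.
  move=> [Fb F0 _ _].
  have -> : F = nseq (size b) [::].
    rewrite -Fb size_map; elim: F F0 {Fb} => //= r F IH /andP[r0 /IH <-].
    by case: r r0.
  rewrite (_ : all _ b) ?inE //; rewrite -Fb.
  elim: F F0 {Fb} => //= r F IH /andP[r0 /IH ->]; rewrite andbT.
  by case: r r0.
apply: (iffP allpairsPdep) => [[g [F' []]]|H].
  rewrite mem_filter => /andP[/asboolP st gb] /IH tF' ->.
  have Eg : shape F' = g by case: tF'.
  by rewrite -Eg in st gb tF'; apply: tab_ext.
case: (tab_below H) => gb st tF EF.
exists (shape (below N F)), (below N F); split=> //; last exact/IH.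
by rewrite mem_filter gb andbT; apply/asboolP.
Qed.

Lemma tabs_uniq N b : uniq (tabs N b).
Proof.
elim: N b => [|N IH] b /=; first by case: ifP.
apply: allpairs_uniq_dep; [by rewrite filter_uniq ?subs_uniq | by [] |].
have inj g F : g \in [seq g <- subs b | `[< strip s (p N) b g >]] ->
    F \in tabs N g -> below N (ext N b F) = F /\ shape F = g.
  rewrite mem_filter => /andP[_ /subsP[sz _]] /tabsP[Eg FN _ _].
  by split=> //; apply: below_ext => //; rewrite -sz -Eg size_map.
move=> x y /allpairsPdep[g [F [gS FT ->]]] /allpairsPdep[g' [F' [gS' FT' ->]]] /= E.
have [B1 S1] := inj _ _ gS FT; have [B2 S2] := inj _ _ gS' FT'.
by have EF : F = F' by [rewrite -B1 E]; subst F'; subst g g'.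
Qed.

End Tableaux.

(** * Generating functions of tableaux as values of [run] *)

Section TableauSums.
Variables (R : comNzRingType) (s p : nat -> bool).
Hypothesis s0 : s 0%N.
Implicit Types (F : seq (seq nat)) (b : seq nat) (x : nat -> R).

Definition word N x : seq (bool * R) := [seq (p i, x i) | i <- rev (iota 0 N)].

Lemma wordS N x : word N.+1 x = (p N, x N) :: word N x.
Proof. by rewrite /word -addn1 iotaD cats1 rev_rcons. Qed.

Lemma prod_ext N b F x : shape F \in subs b ->
  \prod_(c <- flatten (ext N b F)) x c =
    x N ^+ (sumn b - sumn (shape F)) * \prod_(c <- flatten F) x c.
Proof.
elim: F b => [|r F IH] [|y b] //.
- by move=> _; rewrite /= subnn mul1r.
- by case/subsP.
rewrite subs_cons => /allpairsPdep[z [g [Hz Hg [Ez Eg]]]]; subst z g.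
have leg := leq_sumn_subs Hg; move: Hz; rewrite mem_iota => /andP[_ Hz].
rewrite /= big_cat big_cat /= (IH _ Hg) big_cat /=.
have -> : (y + sumn b - (size r + sumn (shape F)) =
    (y - size r) + (sumn b - sumn (shape F)))%N.
  by move: leg Hz; rewrite /shape; lia.
have -> : \prod_(c <- nseq (y - size r) N) x c = x N ^+ (y - size r).
  by rewrite big_nseq -Monoid.iteropE.
by rewrite exprD; ring.
Qed.

Lemma sum_tabs N x b :
  \sum_(F <- tabs s p N b) \prod_(c <- flatten F) x c = run s (word N x) b.
Proof.
elim: N b => [|N IH] b.
  rewrite /= /word /=; case: ifP => _; last by rewrite big_nil.
  by rewrite big_seq1; elim: (size b) => //=; rewrite big_nil.
rewrite wordS /= /strip_op big_allpairs_dep big_filter.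
rewrite big_seq_cond [RHS]big_seq_cond; apply: eq_bigr => g /andP[gb _].
rewrite -IH mulr_sumr big_seq [RHS]big_seq; apply: eq_bigr => F /tabsP[] // Eg _ _ _.
by rewrite -Eg prod_ext // Eg.
Qed.

End TableauSums.

(** * From tableaux over an ordered alphabet to tableaux of integers *)

Section TableauTransfer.
Local Open Scope nat_scope.
Context {disp : Order.disp_t} {T : orderType disp}.
Implicit Types (F : seq (seq T)) (c d : T).

(** [column] drops missing cells, so its neighbours may come from distant rows; transitivity turns
    sortedness into a condition on all pairs of existing cells. *)
Lemma columnP (e : rel T) F q : transitive e ->
  reflect (forall i j c d, i < j -> hat F i q = Some c -> hat F j q = Some d -> e c d)
          (sorted e (column F q)).
Proof.
move=> e_tr; rewrite sorted_pairwise //.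
have inC F' d : reflect (exists j, hat F' j q = Some d) (d \in column F' q).
  apply: (iffP idP).
    rewrite mem_pmap => /mapP[r /(nthP [::])[j _ <-] E].
    by exists j.
  case=> j E; rewrite mem_pmap; apply/mapP; exists (nth [::] F' j); last exact: (esym E).
  apply: mem_nth; rewrite ltnNge; apply/negP => le.
  by rewrite /hat nth_default // onth0n in E.
elim: F => [|r F IH] /=.
  by left=> i j c d _; rewrite /hat nth_nil onth0n.
rewrite /column /= -/(column F q); case Er: (onth r q) => [a|] /=.
  apply: (iffP andP) => [[/allP Ha /IH H] [|i] [|j] // c d lt|H].
  - by rewrite /hat /= Er => -[<-] E; apply: Ha; apply/inC; exists j.
  - by move=> E1 E2; apply: (H i j).
  split; first by apply/allP => d /inC[j E]; apply: (H 0 j.+1).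
  by apply/IH => i j c d lt E1 E2; apply: (H i.+1 j.+1).
apply: (iffP IH) => H i j c d lt; last by apply: (H i.+1 j.+1).
case: i j lt => [|i] [|j] //= lt; first by rewrite /hat /= Er.
by apply: (H i j).
Qed.

Variables (s p : nat -> bool) (v : T -> nat) (N : nat).
Hypothesis v_mono : {mono v : c d / (c <= d)%O >-> (c <= d)%N}.

Definition col_rel m n := (m < n) || (m == n) && p m.

Lemma tab_map (r e : rel T) F (b : seq nat) :
  (forall c d, r c d = row_rel p (v c) (v d)) ->
  (forall c d, e c d = col_rel (v c) (v d)) ->
  tab s p N b (map (map v) F) <->
  [/\ shape F = b, all (all (fun c => v c < N)) F, all (sorted r) F,
    (forall q, s q -> sorted e (column F q)) &
    forall i j q c, i < j -> ~~ s q -> hat F i q = Some c ->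
      if p (v c) then lt_hat (hat F j q.-1) (Some c) -> le_hat (hat F j q) (Some c)
      else le_hat (hat F j q.-1) (Some c) -> lt_hat (hat F j q) (Some c)].
Proof.
move=> rE eE.
have e_tr : transitive e.
  by move=> d c a; rewrite !eE /col_rel => H1 H2; case: eqP H1; case: eqP H2; lia.
(* Infinity becomes [N], which exceeds the value of every entry, so [le_hat] and [lt_hat] against an
   existing entry become comparisons of integers. *)
pose hv (x : option T) := if x is Some c then v c else N.
have shE : shape (map (map v) F) = shape F.
  by rewrite /shape -map_comp; apply: eq_map => l /=; rewrite size_map.
have allE : all (all (fun n => n < N)) (map (map v) F) = all (all (fun c => v c < N)) F.
  by rewrite all_map; apply: eq_all => l /=; rewrite all_map.
have rowE : all (sorted (row_rel p)) (map (map v) F) = all (sorted r) F.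
  rewrite all_map; apply: eq_all => l /=; rewrite sorted_map.
  by case: l => //= a l; apply: eq_path => c d; rewrite rE.
have entE i q : entry N (map (map v) F) i q = hv (hat F i q).
  rewrite /entry /hat; have -> : nth [::] (map (map v) F) i = map v (nth [::] F i).
    by case: (ltnP i (size F)) => H; [rewrite (nth_map [::]) | rewrite !nth_default ?size_map].
  by rewrite -odflt_onth onth_map; case: onth.
have vlt : all (all (fun c => v c < N)) F -> forall i q c, hat F i q = Some c -> v c < N.
  move=> FN i q c E; have cin : c \in nth [::] F i by apply/onthP; exists q.
  have lti : i < size F by rewrite ltnNge; apply/negP => le; rewrite nth_default in cin.
  by apply: (allP (allP FN _ (mem_nth [::] lti))).
rewrite /tab shE allE rowE; split=> -[Fb FN Fr].
  move=> H; have {}H i j q c : i < j -> hat F i q = Some c ->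
      cell_rule (p (v c)) (s q) (v c) (hv (hat F j q.-1)) (hv (hat F j q)).
    move=> lt E; have := H i j q lt; rewrite !entE E /=; apply; exact: vlt E.
  split=> // [q sq|i j q c lt sq E].
    apply/columnP => // i j c d lt E1 E2; have := H i j q c lt E1.
    by rewrite /cell_rule sq E2 eE /col_rel /= -/(hv _); case: (p (v c)); lia.
  have := H i j q c lt E; rewrite /cell_rule (negPf sq) /lt_hat.
  have lc := vlt FN _ _ _ E.
  case E1: (hat F j q.-1) => [d1|]; case E2: (hat F j q) => [d2|] /=;
    rewrite -?v_mono; case: (p (v c)) => //=; rewrite -?v_mono; lia.
move=> Hc Hn; split=> // i j q lt; rewrite !entE.
case E: (hat F i q) => [c|] /=; last by rewrite ltnn.
move=> lc; rewrite /cell_rule; case: (boolP (s q)) => sq.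
  have := elimT (columnP F q e_tr) (Hc q sq) i j c _ lt E.
  case: (hat F j q) => [d|] /=; last by case: (p (v c)); lia.
  by move=> /(_ d erefl); rewrite eE /col_rel; case: (p (v c)); lia.
have := Hn i j q c lt sq E; rewrite /lt_hat.
case E1: (hat F j q.-1) => [d1|]; case E2: (hat F j q) => [d2|] /=;
    rewrite -?v_mono; case: (p (v c)) => //=; rewrite -?v_mono; lia.
Qed.

End TableauTransfer.

(** * Sums over sets as sums over lists, and bounds on cells *)

Lemma fsum_seq (R : nmodType) (T : choiceType) (A : set T) (r : seq T) (f : T -> R) :
  uniq r -> (forall x, x \in r -> A x) ->
  (forall x, A x -> x \notin r -> f x = 0) ->
  \sum_(x \in A) f x = \sum_(x <- r) f x.
Proof.
move=> ur rA r0; rewrite (fsbigE r) //.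
rewrite big_seq_cond [RHS]big_seq; apply: eq_bigl => x; rewrite andb_idr //.
by move=> /rA Ax; rewrite inE.
Qed.

Lemma sum_indicator (R : pzSemiRingType) (T : eqType) (r : seq T) (a : T) (h : T -> R) :
  uniq r -> a \in r -> \sum_(x <- r) (a == x)%:R * h x = h a.
Proof.
move=> ur ar; rewrite (bigD1_seq a) //= eqxx mul1r big1 ?addr0 // => x.
by rewrite eq_sym => /negPf->; rewrite mul0r.
Qed.

Definition first_column (q : nat) : bool := q == 0%N.

Lemma nth_max_part (b : seq nat) i : (nth 0 b i <= max_part b)%N.
Proof.
case: (ltnP i (size b)) => H; last by rewrite nth_default.
by apply: leq_bigmax_seq => //; apply: mem_nth.
Qed.

Lemma hat_lt (disp : Order.disp_t) (T : orderType disp) (F : seq (seq T)) i q c :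
  hat F i q = Some c -> (q < nth 0 (shape F) i)%N.
Proof. by move=> E; rewrite nth_shape -onthTE -/(hat F i q) E. Qed.

(** * [HS] and [HQ] as values of [run] *)

Section Hook.
Variables k l : nat.
Local Notation N := (k + l)%N.
Implicit Types (F : seq (seq 'I_N)) (b : seq nat).

Definition hook_primed (c : nat) : bool := (k <= c)%N.

Lemma hook_rowE (c d : 'I_N) : hook_row c d = row_rel hook_primed c d.
Proof.
rewrite /hook_row /row_rel /unprimed /hook_primed leEord -ltnNge leq_eqVlt.
by rewrite -(inj_eq val_inj) /=; case: eqP => [->|]; rewrite ?ltnn ?orbF //= andbT.
Qed.

Lemma hook_colE (c d : 'I_N) : hook_col c d = col_rel hook_primed c d.
Proof.
rewrite /hook_col /col_rel /primed /unprimed /hook_primed leEord -leqNgt leq_eqVlt.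
by rewrite -(inj_eq val_inj) /=; case: eqP => [->|]; rewrite ?ltnn ?orbF //= andbT.
Qed.

Lemma val_mono : {mono (@nat_of_ord N) : c d / (c <= d)%O >-> (c <= d)%N}.
Proof. by move=> c d; rewrite leEord. Qed.

Lemma all_ord F : all (all (fun c : 'I_N => (c < N)%N)) F.
Proof. by apply/allP => r _; apply/allP => c _. Qed.

Lemma SSHT_tab b F : SSHT b F <-> tab xpredT hook_primed N b (map (map (@nat_of_ord N)) F).
Proof.
have tm := @tab_map _ _ xpredT hook_primed (@nat_of_ord N) N val_mono _ _ F b hook_rowE
  hook_colE.
split=> [[Fb Fr Fc]|/tm[Fb _ Fr Fc _]]; last by split=> // j; apply: Fc.
by apply/tm; split=> //; apply: all_ord.
Qed.

Lemma HCT_tab b F : HCT b F <-> tab first_column hook_primed N b (map (map (@nat_of_ord N)) F).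
Proof.
have tm := @tab_map _ _ first_column hook_primed (@nat_of_ord N) N val_mono _ _ F b hook_rowE
  hook_colE.
split=> [[Fb Fr Fc Fn]|/tm[Fb _ Fr Fc Fn]].
  apply/tm; split=> //; first exact: all_ord; first by move=> q /eqP->.
  move=> i j [//|q] c lt_ij _ E.
  (* [tab] ranges over all [j]; rows beyond the shape consist of infinities, for which the rule is
     trivial. *)
  case: (ltnP j (size b)) => lt_j; last first.
    rewrite /lt_hat /hat !(nth_default [::]) ?onth0n /=; last 1 first.
      by rewrite -(size_map size) -/(shape F) Fb.
    by case: ifP.
  have := Fn i j q; rewrite lt_ij lt_j => /(_ isT) H.
  have [|H1 H2] := H _ c E.
    by apply: leq_trans (hat_lt E) _; rewrite Fb nth_max_part.
  by case: ifP => pc; [apply: H2; rewrite /primed /unprimed -leqNgt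
    | apply: H1; rewrite /unprimed ltnNge -/(hook_primed c) pc].
split=> //; first exact: Fc.
move=> i j q /andP[lt_ij _] _ c E; have /= := Fn i j q.+1 c lt_ij isT E.
rewrite /primed /unprimed -leqNgt ltnNge -/(hook_primed c).
by case: (hook_primed c) => H.
Qed.

Definition hook_var (c : nat) : {mpoly int[k + l]} :=
  if insub c is Some i then 'X_(i : 'I_N) else 0.

(** Entries of the listed integer tableaux are below [N], so [lift] drops none of them and inverts
    the inclusion of ordinals into integers. *)
Lemma sum_hook (P : seq (seq 'I_N) -> Prop) (s : nat -> bool) b : s 0%N ->
  (forall F, P F <-> tab s hook_primed N b (map (map (@nat_of_ord N)) F)) ->
  \sum_(F \in [set F | P F]%classic) hook_monom F =
    run s (word hook_primed N hook_var) b.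
Proof.
move=> s0 PE; rewrite -sum_tabs //.
pose lift (G : seq (seq nat)) : seq (seq 'I_N) := map (pmap insub) G.
have liftK G : G \in tabs s hook_primed N b -> map (map (@nat_of_ord N)) (lift G) = G.
  move=> /(tabsP _ s0)[_ /allP GN _ _]; rewrite -map_comp -[RHS]map_id.
  apply/eq_in_map => r /GN /= rN; rewrite pmap_filter; last exact: insubK.
  apply/all_filterP; apply: sub_all rN => c cN.
  by rewrite insubT.
rewrite (@fsum_seq _ _ _ [seq lift G | G <- tabs s hook_primed N b]).
- rewrite big_map big_seq [RHS]big_seq; apply: eq_bigr => G /liftK {2}<-.
  rewrite /hook_monom -map_flatten big_map; apply: eq_bigr => c _.
  by rewrite /hook_var valK.
- rewrite map_inj_in_uniq ?tabs_uniq // => G G' /liftK {2}<- /liftK {2}<-.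
  by move=> ->.
- by move=> F /mapP[G GT ->]; apply/PE; rewrite liftK //; apply/tabsP.
move=> F /PE /(tabsP _ s0) FT /negP[]; apply/mapP; exists (map (map (@nat_of_ord N)) F) => //.
rewrite /lift -map_comp -[LHS]map_id; apply: eq_map => r /=.
by rewrite (map_pK valK).
Qed.

Lemma HS_run b : HS k l b = run xpredT (word hook_primed N hook_var) b.
Proof. by apply: sum_hook => // F; apply: SSHT_tab. Qed.

Lemma HQ_run b : HQ k l b = run first_column (word hook_primed N hook_var) b.
Proof. by apply: sum_hook => // F; apply: HCT_tab. Qed.

End Hook.

(** * Tableaux with positive integer entries *)

Lemma all_flatten (T : Type) (a : pred T) (ss : seq (seq T)) :
  all a (flatten ss) = all (all a) ss.
Proof. by elim: ss => //= r ss IH; rewrite all_cat IH. Qed.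

(** The letter 0 belongs to the alphabet of [tab], so positivity stays a separate condition,
    enforced later by giving that letter the value 0. *)
Lemma SSYT_tab N b (F : seq (seq nat)) : all (all (fun c => c < N)%N) F ->
  SSYT b F <-> positive_entries F /\ tab xpredT xpred0 N b F.
Proof.
move=> FN; have rE (c d : nat) : (c <= d)%O = row_rel xpred0 (id c) (id d).
  by rewrite /row_rel leEnat leq_eqVlt orbC andbT.
have cE (c d : nat) : (c < d)%O = col_rel xpred0 (id c) (id d).
  by rewrite /col_rel ltEnat andbF orbF.
have := @tab_map _ _ xpredT xpred0 id N (fun c d => erefl) _ _ F b rE cE.
have -> : map (map id) F = F by rewrite -[RHS]map_id; apply: eq_map => r; apply: map_id.
move=> tm; split=> [[Fb Fp Fr Fc]|[Fp /tm[Fb _ Fr Fc _]]]; last by split=> // j; apply: Fc.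
by split=> //; apply/tm; split.
Qed.

Lemma SSYCT_tab N b (F : seq (seq nat)) : all (all (fun c => c < N)%N) F ->
  SSYCT b F <-> positive_entries F /\ tab first_column xpred0 N b F.
Proof.
move=> FN; have rE (c d : nat) : (c <= d)%O = row_rel xpred0 (id c) (id d).
  by rewrite /row_rel leEnat leq_eqVlt orbC andbT.
have cE (c d : nat) : (c < d)%O = col_rel xpred0 (id c) (id d).
  by rewrite /col_rel ltEnat andbF orbF.
have := @tab_map _ _ first_column xpred0 id N (fun c d => erefl) _ _ F b rE cE.
have -> : map (map id) F = F by rewrite -[RHS]map_id; apply: eq_map => r; apply: map_id.
move=> tm; split=> [[Fb Fp Fr Fc Fn]|[Fp /tm[Fb _ Fr Fc Fn]]].
  split=> //; apply/tm; split=> // [q /eqP->//|i j [//|q] c lt_ij _ E /=].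
  case: (ltnP j (size b)) => lt_j; last first.
    rewrite /lt_hat /hat !(nth_default [::]) ?onth0n //=.
    by rewrite -(size_map size) -/(shape F) Fb.
  have := Fn i j q; rewrite lt_ij lt_j E => /(_ isT) H; apply: H => //.
  by apply: leq_trans (hat_lt E) _; rewrite Fb nth_max_part.
split=> //; first exact: Fc.
move=> i j q /andP[lt_ij _] _; case E: (hat F i q.+1) => [c|] // _.
exact: (Fn i j q.+1 c lt_ij isT E).
Qed.

(** * Evaluating the power series identity in finitely many variables *)

Section Evaluation.
Variables (N : nat).
Implicit Types (m : cmonom nat) (F : seq (seq nat)) (s : nat -> bool) (b : seq nat).

Definition bounded_monom m := forall i, (N <= i)%N -> m i = 0%N.

Lemma series_monomE F i : series_monom F i = count_mem i (flatten F).
Proof.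
rewrite /series_monom; elim: (flatten F) => [|c r IH]; first by rewrite big_nil cm1.
by rewrite big_cons cmM cmU IH.
Qed.

Lemma bounded_series_monomP F :
  reflect (bounded_monom (series_monom F)) (all (all (fun c => c < N)%N) F).
Proof.
rewrite -all_flatten; apply: (iffP allP) => [H i le|H c cF].
  rewrite series_monomE; apply/count_memPn; apply/negP => /H /=; lia.
rewrite ltnNge; apply/negP => /H; rewrite series_monomE => /count_memPn.
by rewrite cF.
Qed.

Definition tableaux (s : nat -> bool) b :=
  [seq F <- tabs s xpred0 N b | positive_entries F].

Lemma tableaux_uniq s b : s 0%N -> uniq (tableaux s b).
Proof. by move=> s0; rewrite filter_uniq ?tabs_uniq. Qed.

Lemma tableaux_bounded s b F : s 0%N ->
  F \in tableaux s b -> bounded_monom (series_monom F).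
Proof.
move=> s0; rewrite mem_filter => /andP[_ /(tabsP _ s0)[_ FN _ _]].
exact/bounded_series_monomP.
Qed.

(** A tableau with a bounded monomial has all its entries below [N], so it occurs in a finite
    list. *)
Lemma tableau_series_bounded (P : seq (seq nat) -> Prop) s b m : s 0%N ->
  (forall F, all (all (fun c => c < N)%N) F ->
     P F <-> positive_entries F /\ tab s xpred0 N b F) ->
  bounded_monom m ->
  tableau_series [set F | P F]%classic m =
    \sum_(F <- tableaux s b) (series_monom F == m)%:R.
Proof.
move=> s0 PE bm; apply: fsum_seq; first exact: tableaux_uniq.
  move=> F; rewrite mem_filter => /andP[Fp /(tabsP _ s0) FT]; apply/PE => //.
  by case: FT.
move=> F PF nF; case: eqP => // E; case/negP: nF.
have FN : all (all (fun c => c < N)%N) F by apply/bounded_series_monomP; rewrite E.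
by have [Fp FT] := iffLR (PE F FN) PF; rewrite mem_filter Fp; apply/tabsP.
Qed.

Lemma CS_bounded b m : bounded_monom m ->
  CS b m = \sum_(F <- tableaux first_column b) (series_monom F == m)%:R.
Proof. by apply: tableau_series_bounded => // F; apply: SSYCT_tab. Qed.

Lemma schur_bounded b m : bounded_monom m ->
  schur b m = \sum_(F <- tableaux xpredT b) (series_monom F == m)%:R.
Proof. by apply: tableau_series_bounded => // F; apply: SSYT_tab. Qed.

(** Both factors of a bounded monomial are bounded, so the convolution only involves the finitely
    many tableaux with entries below [N]. *)
Lemma series_mul_bounded a b m : bounded_monom m ->
  series_mul (CS a) (schur b) m =
  \sum_(F <- tableaux first_column a) \sum_(G <- tableaux xpredT b)
    (mmul (series_monom F) (series_monom G) == m)%:R.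
Proof.
move=> bm.
pose L1 := undup (map series_monom (tableaux first_column a)).
pose L2 := undup (map series_monom (tableaux xpredT b)).
pose L := [seq q <- [seq (m1, m2) | m1 <- L1, m2 <- L2] | mmul q.1 q.2 == m].
have bq q : mmul q.1 q.2 = m -> bounded_monom q.1 /\ bounded_monom q.2.
  by move=> E; split=> i /bm; rewrite -E cmM; lia.
have uL : uniq L.
  by rewrite filter_uniq // allpairs_uniq ?undup_uniq // => -[x y] [x' y'].
have zero (s : nat -> bool) c m1 : m1 \notin undup (map series_monom (tableaux s c)) ->
    \sum_(F <- tableaux s c) (series_monom F == m1)%:R = 0 :> int.
  rewrite mem_undup => H; rewrite big_seq big1 // => F FT; case: eqP => // E.
  by case/negP: H; rewrite -E map_f.
rewrite /series_mul (@fsum_seq _ _ _ L) //.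
- transitivity (\sum_(q <- L) \sum_(F <- tableaux first_column a)
    \sum_(G <- tableaux xpredT b) ((series_monom F, series_monom G) == q)%:R * 1 : int).
    rewrite big_seq [RHS]big_seq; apply: eq_bigr => -[m1 m2].
    rewrite mem_filter => /andP[/eqP/bq[b1 b2] _].
    rewrite CS_bounded // schur_bounded // mulr_suml; apply: eq_bigr => F _.
    rewrite mulr_sumr; apply: eq_bigr => G _.
    by rewrite mulr1 xpair_eqE -natrM mulnb.
  rewrite exchange_big big_seq [RHS]big_seq; apply: eq_bigr => F FT.
  rewrite exchange_big big_seq [RHS]big_seq; apply: eq_bigr => G GT.
  case: eqP => [E|ne].
    rewrite sum_indicator // mem_filter E eqxx /=.
    by apply: allpairs_f; rewrite mem_undup map_f.
  rewrite big_seq big1 // => q; rewrite mem_filter => /andP[/eqP Eq _].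
  by case: eqP => [Ep|]; [rewrite -Ep in Eq | rewrite mul0r].
- by move=> q; rewrite mem_filter => /andP[/eqP].
move=> [m1 m2] Em; have [b1 b2] := bq _ Em; rewrite CS_bounded // schur_bounded //=.
rewrite mem_filter Em eqxx /= => H.
have [H1|/zero->] := boolP (m1 \in L1); last by rewrite mul0r.
have [H2|/zero->] := boolP (m2 \in L2); last by rewrite mulr0.
by case/negP: H; apply: allpairs_f.
Qed.

Variables (R : comNzRingType) (x : nat -> R).
Hypothesis x0 : x 0%N = 0.

Definition eval_monom m : R := \prod_(i < N) x i ^+ m i.

Lemma eval_monomM m1 m2 : eval_monom (mmul m1 m2) = eval_monom m1 * eval_monom m2.
Proof.
by rewrite /eval_monom -big_split; apply: eq_bigr => i _; rewrite cmM exprD.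
Qed.

Lemma eval_series_monom F : all (all (fun c => c < N)%N) F ->
  eval_monom (series_monom F) = \prod_(c <- flatten F) x c.
Proof.
rewrite -all_flatten /series_monom; elim: (flatten F) => [|c r IH] /=.
  by rewrite !big_nil /eval_monom big1 // => i _; rewrite cm1.
move=> /andP[cN /IH E]; rewrite !big_cons eval_monomM E; congr (_ * _).
rewrite /eval_monom (bigD1 (Ordinal cN)) //= cmU eqxx expr1 big1 ?mulr1 // => i ne.
rewrite cmU; case: eqP => // Ec; case/eqP: ne; exact: val_inj.
Qed.

(** Tableaux containing the letter 0 may be added freely: their product has the factor [x 0 = 0]. *)
Lemma sum_tableaux s b : s 0%N ->
  \sum_(F <- tableaux s b) eval_monom (series_monom F) = run s (word xpred0 N x) b.
Proof.
move=> s0; rewrite -sum_tabs // big_filter [RHS](bigID positive_entries) /=.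
rewrite [X in _ + X]big1 ?addr0 => [|F].
  rewrite big_seq_cond [RHS]big_seq_cond; apply: eq_bigr => F.
  by move=> /andP[/(tabsP _ s0)[_ FN _ _] _]; apply: eval_series_monom.
rewrite /positive_entries -all_flatten -has_predC => /hasP[c cF].
rewrite /= -leqNgt leqn0 => /eqP Ec; subst c.
by rewrite (perm_big _ (perm_to_rem cF)) big_cons /= x0 mul0r.
Qed.

(** The coefficient identities are added over a finite list of monomials, each weighted by the value
    of its monomial. *)
Lemma run_of_series (a m : seq nat) (B : seq (seq nat)) (P : pred (seq nat))
    (A : seq nat -> int) :
  (forall u : cmonom nat, series_mul (CS a) (schur m) u =
     \sum_(b <- B | P b) A b * CS b u) ->
  run first_column (word xpred0 N x) a * run xpredT (word xpred0 N x) m =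
  \sum_(b <- B | P b) (A b)%:~R * run first_column (word xpred0 N x) b.
Proof.
move=> H; pose mon := series_monom.
(* Every monomial contributed by either side through tableaux with entries below [N]. *)
pose L := undup ([seq mmul (mon F) (mon G) | F <- tableaux first_column a,
                    G <- tableaux xpredT m] ++
   flatten [seq map mon (tableaux first_column b) | b <- B]).
have bL u : u \in L -> bounded_monom u.
  rewrite mem_undup mem_cat => /orP[/allpairsPdep[F [G [FT GT ->]]] i lt|].
    rewrite cmM (tableaux_bounded _ FT) // (tableaux_bounded _ GT) //.
  by move=> /flatten_mapP[b _ /mapP[F FT ->]]; apply: tableaux_bounded FT.
have uL : uniq L by apply: undup_uniq.
transitivity (\sum_(u <- L) (series_mul (CS a) (schur m) u)%:~R * eval_monom u).
  transitivity (\sum_(u <- L) \sum_(F <- tableaux first_column a)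
      \sum_(G <- tableaux xpredT m) (mmul (mon F) (mon G) == u)%:R * eval_monom u).
    rewrite exchange_big /= -!sum_tableaux // mulr_suml.
    rewrite big_seq [RHS]big_seq; apply: eq_bigr => F FT.
    rewrite exchange_big /= mulr_sumr.
    rewrite big_seq [RHS]big_seq; apply: eq_bigr => G GT.
    rewrite sum_indicator ?eval_monomM // mem_undup mem_cat; apply/orP; left.
    exact: allpairs_f.
  rewrite big_seq [RHS]big_seq; apply: eq_bigr => u /bL bu.
  rewrite series_mul_bounded // rmorph_sum mulr_suml; apply: eq_bigr => F _.
  rewrite rmorph_sum mulr_suml; apply: eq_bigr => G _.
  by rewrite rmorph_nat.
transitivity (\sum_(u <- L) \sum_(b <- B | P b) \sum_(F <- tableaux first_column b)
    (A b)%:~R * ((mon F == u)%:R * eval_monom u)).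
  rewrite big_seq [RHS]big_seq; apply: eq_bigr => u /bL bu.
  rewrite H rmorph_sum mulr_suml; apply: eq_bigr => b _.
  rewrite CS_bounded // rmorphM rmorph_sum -mulrA mulr_suml mulr_sumr.
  by apply: eq_bigr => F _; rewrite rmorph_nat.
rewrite exchange_big /= big_seq_cond [RHS]big_seq_cond; apply: eq_bigr => b /andP[bB _].
rewrite exchange_big /= -sum_tableaux // mulr_sumr.
rewrite big_seq [RHS]big_seq; apply: eq_bigr => F FT.
rewrite -mulr_sumr sum_indicator // mem_undup mem_cat; apply/orP; right.
by apply/flatten_mapP; exists b => //; apply: map_f.
Qed.

End Evaluation.

(** * Unprimed words as evaluations, and the conclusion *)

Lemma unprimed_word (R : comNzRingType) (w : seq (bool * R)) :
  all (fun t => ~~ t.1) w ->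
  exists2 x : nat -> R, x 0%N = 0 &
    word xpred0 (size w).+1 x = w ++ [:: (false, 0)].
Proof.
elim: w => [|[p t] w IH] /=; first by exists (fun=> 0).
case: p => //= /IH[x x0 E].
(* Letters are numbered from the end of the word, the appended one being 0; the new head therefore
   has number [(size w).+1]. *)
exists (fun i => if i == (size w).+1 then t else x i) => //.
rewrite wordS eqxx -E; congr (_ :: _); apply/eq_in_map => i.
by rewrite mem_rev mem_iota => /andP[_ lt]; case: eqP => // Ei; lia.
Qed.

Lemma run_rcons0 (R : comNzRingType) (s : nat -> bool) (w : seq (bool * R)) b :
  run s (w ++ [:: (false, 0)]) b = run s w b.
Proof.
by elim: w b => [|t w IH] b /=; [apply: strip_op0 | apply: eq_strip_op].
Qed.

Theorem theorem7p2 (alpha mu : seq nat) (A : {fsfun seq nat -> int with 0}) :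
  is_composition alpha -> is_partition mu ->
  (forall m : monalg.cmonom nat,
     series_mul (CS alpha) (schur mu) m =
     \sum_(b <- finsupp A | is_composition b && subcomp alpha b)
        A b * CS b m) ->
  forall k l : nat,
    HQ k l alpha * HS k l mu =
    \sum_(b <- finsupp A | is_composition b && subcomp alpha b)
        A b *: HQ k l b.
Proof.
move=> _ _ H k l.
transitivity (\sum_(b <- finsupp A | is_composition b && subcomp alpha b)
    (A b)%:~R * run first_column (word (hook_primed k) (k + l) (hook_var k l)) b).
  (* The identity is proved for every word over the polynomial ring. Superization leaves the
     unprimed words, whose letters are realized as values of variables so that the hypothesis
     applies. *)
  rewrite HQ_run HS_run; apply: run_superization => w /unprimed_word[x x0 E].
  rewrite -!(run_rcons0 _ w) -E (run_of_series _ x0 H) //; apply: eq_bigr => b _.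
  by rewrite E run_rcons0.
by apply: eq_bigr => b _; rewrite HQ_run mulrzl -scaler_int intz.
Qed.
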